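(* Let $n\ge1$, $x_1,\dots,x_n\in\mathbb{R}_{>0}$, and let $\lambda$ be a partition. The Markov chain on $\mathrm{bMLQ}(\lambda,n)$ defined by the (forward) bosonic ringing paths has an unnormalized stationary distribution given by $\mathrm{wt}(\mathbf{D})=\mathbf{x}^{\mathbf{D}}$, where $\mathbf{x}^{\mathbf{D}}$ is the weight of $\mathbf{D}$; that is, for every $\mathbf{D}\in\mathrm{bMLQ}(\lambda,n)$, $$\mathrm{wt}(\mathbf{D})\sum_{\mathbf{D}'\in\mathrm{bMLQ}(\lambda,n)}\mathrm{rate}(\mathbf{D},\mathbf{D}')=\sum_{\mathbf{D}'\in\mathrm{bMLQ}(\lambda,n)}\mathrm{wt}(\mathbf{D}')\,\mathrm{rate}(\mathbf{D}',\mathbf{D}).$$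
   Context: Fix $n\ge1$; sites are $\mathbb{Z}_n=\{1,\dots,n\}$ with $n+1\equiv1$. $\mathcal{M}(n)$ is the set of finite multisets with entries in $[n]=\{1,\dots,n\}$. For a partition $\lambda=(\lambda_1\ge\dots\ge\lambda_L\ge0)$, $\mathrm{bMLQ}(\lambda,n)$ is the set of bosonic multiline queues of type $(\lambda,n)$: tuples $\mathbf{D}=(D_1,\dots,D_L)$ with $D_j\in\mathcal{M}(n)$ and $|D_j|=\lambda_j$. The weight is $\mathbf{x}^{\mathbf{D}}=\prod_{i=1}^n x_i^{m_i(\mathbf{D})}$, where $m_i(\mathbf{D})$ is the total multiplicity of $i$ in $D_1,\dots,D_L$. Markov chain: for $\mathbf{D}=(D_1,\dots,D_L)$ and $i\in\mathbb{Z}_n$, the ringing path at site $i$ is the sequence $\mathfrak{a}_1,\dots,\mathfrak{a}_{L+1}$ with $\mathfrak{a}_1=i$ and, for $2\le j\le L+1$, $\mathfrak{a}_j=\mathfrak{a}_{j-1}$ if $\mathfrak{a}_{j-1}\notin D_{j-1}$ and $\mathfrak{a}_j=\mathfrak{a}_{j-1}+1$ otherwise. Let $\widetilde F_i(\mathbf{D})=(D_1',\dots,D_L')$ where $D_j'=D_j$ if $\mathfrak{a}_j\notin D_j$, and otherwise $D_j'$ is $D_j$ with one copy of $\mathfrak{a}_j$ replaced by $\mathfrak{a}_j+1$. For each $i\in\mathbb{Z}_n$ there is a transition $\mathbf{D}\to\widetilde F_i(\mathbf{D})$ with rate $x_i^{-1}$ if column $i$ of $\mathbf{D}$ is nonempty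 (some $D_j$ contains $i$), and rate $1$ if column $i$ is empty (in which case $\widetilde F_i(\mathbf{D})=\mathbf{D}$); $\mathrm{rate}(\mathbf{D},\mathbf{D}')$ is the total rate of the transitions from $\mathbf{D}$ to $\mathbf{D}'$ (summed over the triggering sites $i$). *)

(* Defs.v *)
From HB Require Import structures.
From mathcomp Require Import all_boot all_order all_algebra.
From mathcomp Require Import finmap multiset.

Set Implicit Arguments.
Unset Strict Implicit.
Unset Printing Implicit Defensive.

Local Open Scope mset_scope.

(* Sites are 0-indexed, as elements of 'I_n; ordS is the cyclic successor.
   Rows are 0-indexed too: the row called D_(j+1) on paper is tnth D j.

   For A : {mset 'I_n}, A i is the multiplicity of i in A, and size A is the
   cardinality of A counted with multiplicity (whereas #|A| would count the
   distinct elements). *)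

Record bMLQ (n L : nat) (lam : L.-tuple nat) : predArgType := BMLQ {
  bmlq_rows :> L.-tuple {mset 'I_n};
  bmlq_size : [forall j : 'I_L, size (tnth bmlq_rows j) == tnth lam j]
}.

HB.instance Definition _ n L (lam : L.-tuple nat) :=
  [isSub of bMLQ n lam for @bmlq_rows n L lam].
HB.instance Definition _ n L (lam : L.-tuple nat) :=
  [Choice of bMLQ n lam by <:].

Definition bmlq_encode n L (lam : L.-tuple nat) (D : bMLQ n lam) :
    L.-tuple ((sumn lam).-bseq 'I_n) :=
  [tuple insub_bseq (sumn lam) (enum_mset (tnth D j)) | j < L].

Definition bmlq_decode n L (lam : L.-tuple nat)
    (e : L.-tuple ((sumn lam).-bseq 'I_n)) : option (bMLQ n lam) :=
  insub [tuple seq_mset (bseqval (tnth e j)) | j < L].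

Lemma bmlq_encodeK n L (lam : L.-tuple nat) :
  pcancel (@bmlq_encode n L lam) (@bmlq_decode n L lam).
Proof.
move=> D; rewrite /bmlq_decode; set t := (X in insub X).
suff -> : t = bmlq_rows D by rewrite valK.
apply: eq_from_tnth => j; rewrite !tnth_mktuple.
have le_size : size (tnth D j) <= sumn lam.
  rewrite (eqP (forallP (bmlq_size D) j)) sumnE big_tuple.
  by rewrite (bigD1 j) //= leq_addr.
by rewrite val_insubd le_size seq_mset_id.
Qed.

HB.instance Definition _ n L (lam : L.-tuple nat) :=
  PCanIsCountable (@bmlq_encodeK n L lam).
HB.instance Definition _ n L (lam : L.-tuple nat) : isFinite (bMLQ n lam) :=
  PCanIsFinite (@bmlq_encodeK n L lam).

(* ringing_site D i j is a_(j+1), for 0 <= j <= L. *)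
Fixpoint ringing_site n (D : seq {mset 'I_n}) (i : 'I_n) (j : nat) : 'I_n :=
  if j is j'.+1 then
    let a := ringing_site D i j' in
    if a \in nth mset0 D j' then ordS a else a
  else i.

Definition move_right n (a : 'I_n) (A : {mset 'I_n}) : {mset 'I_n} :=
  if a \in A then ordS a +` (A `\ a) else A.

Definition ringing_rows n L (D : L.-tuple {mset 'I_n}) (i : 'I_n) :
    L.-tuple {mset 'I_n} :=
  [tuple move_right (ringing_site D i j) (tnth D j) | j < L].

Lemma size_move_right n (a : 'I_n) (A : {mset 'I_n}) :
  size (move_right a A) = size A.
Proof.
have size1D (b : 'I_n) (B : {mset 'I_n}) : size (b +` B) = (size B).+1.
  rewrite -[B in LHS]seq_mset_id -mset_cons.
  by rewrite (perm_size (perm_eq_seq_mset _)).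
rewrite /move_right; case: ifPn => // aA.
by rewrite size1D -(size1D a) msetB1K.
Qed.

Lemma ringing_size n L (lam : L.-tuple nat) (D : bMLQ n lam) (i : 'I_n) :
  [forall j : 'I_L, size (tnth (ringing_rows D i) j) == tnth lam j].
Proof.
apply/forallP => j; rewrite tnth_mktuple size_move_right.
exact: (forallP (bmlq_size D) j).
Qed.

Definition ringing n L (lam : L.-tuple nat) (D : bMLQ n lam) (i : 'I_n) :
    bMLQ n lam :=
  BMLQ (ringing_size D i).

Definition column_nonempty n L (lam : L.-tuple nat) (D : bMLQ n lam)
    (i : 'I_n) : bool :=
  [exists j : 'I_L, i \in tnth D j].

Local Open Scope ring_scope.

Definition trigger_rate (R : realFieldType) n L (lam : L.-tuple nat)
    (x : 'I_n -> R) (D : bMLQ n lam) (i : 'I_n) : R :=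
  if column_nonempty D i then (x i)^-1 else 1.

Definition rate (R : realFieldType) n L (lam : L.-tuple nat)
    (x : 'I_n -> R) (D D' : bMLQ n lam) : R :=
  \sum_(i < n | ringing D i == D') trigger_rate x D i.

Definition multiplicity n L (lam : L.-tuple nat) (D : bMLQ n lam)
    (i : 'I_n) : nat :=
  (\sum_(j < L) tnth D j i)%N.

Definition wt (R : realFieldType) n L (lam : L.-tuple nat)
    (x : 'I_n -> R) (D : bMLQ n lam) : R :=
  \prod_(i < n) x i ^+ multiplicity D i.

(* Main.v *)
Require Import Defs.
From mathcomp Require Import all_boot all_order all_algebra.
From mathcomp Require Import finmap multiset.

(** Ringing D at site i also determines the site where the ringing path ends.
    Remembering it makes the dynamics reversible: (D, i) |-> (F_i D, end) is a
    permutation of the pairs (queue, site).  Indeed each row maps (row, entering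
    site a) to (new row, leaving site b), and a particle has moved in that row
    exactly when the new row contains b, so the path can be retraced from its
    end ([row_step_inj], [ringing_rows_inj]).

    This permutation preserves the stationary flow wt(D) * rate, where the rate
    is that of the transition triggered at i.  Each moved particle trades a
    factor x_a for x_(a+1), where a and a+1 are consecutive sites of the path, so
    the weights telescope to wt(F_i D) * x_i = wt(D) * x_end
    ([row_weight_ringing]).  Moreover column i of D is nonempty iff the path
    moves a particle iff column end of F_i D is nonempty ([has_ringing_site]).
    If so, wt(D) / x_i = wt(F_i D) / x_end; otherwise nothing changes and both
    rates are 1.

    The flow into D is the sum of the flows of the pairs sent by the permutation
    to some (D, k); by invariance it equals the sum of the flows of the pairs
    (D, k) themselves, which is the flow out of D. *)

Set Implicit Arguments.
Unset Strict Implicit.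
Unset Printing Implicit Defensive.

Import Order.TTheory GRing.Theory Num.Theory.

Local Open Scope mset_scope.
Local Open Scope ring_scope.

Definition next_site n (a : 'I_n) (A : {mset 'I_n}) : 'I_n :=
  if a \in A then ordS a else a.

(** After the step, the current site tells whether a particle has just moved;
    this is what makes a step invertible. *)
Lemma next_site_in_move_right n (a : 'I_n) (A : {mset 'I_n}) :
  (next_site a A \in move_right a A) = (a \in A).
Proof.
rewrite /next_site /move_right; case: ifPn => [_|/negbTE //].
exact: mset1D1.
Qed.

Lemma row_step_inj n (a b : 'I_n) (A B : {mset 'I_n}) :
  move_right a A = move_right b B -> next_site a A = next_site b B ->
  a = b /\ A = B.
Proof.
move=> eqAB eqab.
have: (a \in A) = (b \in B).
  rewrite -(next_site_in_move_right a) eqAB eqab.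
  exact: next_site_in_move_right.
move: eqAB eqab; rewrite /next_site /move_right.
case: ifPn => aA; case: ifPn => bB // + + _.
move=> + /(can_inj (@ordSK n)) eq_ab; rewrite -{}eq_ab in bB *.
move=> /(congr1 (fun C => C `\ ordS a)); rewrite !msetD1K => eqD.
by split=> //; rewrite -(msetB1K aA) -(msetB1K bB) eqD.
Qed.

Section RowWeight.

Variables (R : realFieldType) (n : nat) (x : 'I_n -> R).

Definition row_weight (A : {mset 'I_n}) : R := \prod_(i < n) x i ^+ A i.

Lemma row_weight_msetD1 (a : 'I_n) (A : {mset 'I_n}) :
  row_weight (a +` A) = x a * row_weight A.
Proof.
rewrite /row_weight (bigD1 a) //= [in RHS](bigD1 a) //= mulrA -exprS.
congr (_ ^+ _ * _); first by rewrite mset1DE eqxx.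
by apply: eq_bigr => i /negbTE neq_ia; rewrite mset1DE neq_ia.
Qed.

Lemma row_weight_move_right (a : 'I_n) (A : {mset 'I_n}) :
  row_weight (move_right a A) * x a = row_weight A * x (next_site a A).
Proof.
rewrite /move_right /next_site; case: ifPn => // aA.
by rewrite -[in RHS](msetB1K aA) !row_weight_msetD1 [LHS]mulrC mulrA mulrAC.
Qed.

End RowWeight.

Section RingingPath.

Variables (n L : nat).
Implicit Types (D E : L.-tuple {mset 'I_n}) (i : 'I_n).

Lemma ringing_siteS (D : seq {mset 'I_n}) i j :
  ringing_site D i j.+1 = next_site (ringing_site D i j) (nth mset0 D j).
Proof. by []. Qed.

(** Past the last row both sides are the empty row, so that all arguments below
    can use natural numbers as row indices. *)
Lemma nth_ringing_rows D i j :
  nth mset0 (ringing_rows D i) j =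
  move_right (ringing_site D i j) (nth mset0 D j).
Proof.
have [ltjL|leLj] := ltnP j L.
  by rewrite -(tnth_nth _ _ (Ordinal ltjL)) tnth_mktuple (tnth_nth mset0).
by rewrite !nth_default ?size_tuple // /move_right in_mset0.
Qed.

(** The path is retraced row by row from its common end [ringing_site _ _ L]
    down to the triggering site. *)
Lemma ringing_rows_inj D E i k :
  ringing_rows D i = ringing_rows E k ->
  ringing_site D i L = ringing_site E k L ->
  D = E /\ i = k.
Proof.
move=> eq_rows eq_end.
have row_step j :
    ringing_site D i j.+1 = ringing_site E k j.+1 ->
    ringing_site D i j = ringing_site E k j /\ nth mset0 D j = nth mset0 E j.
  rewrite !ringing_siteS; apply: row_step_inj.
  by rewrite -!nth_ringing_rows eq_rows.
have eq_sites j : (j <= L)%N -> ringing_site D i j = ringing_site E k j.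
  (* induction on L - j, as the hypothesis is about the end of the path *)
  move=> /subKn <-; elim: (L - j)%N => [|m IHm]; first by rewrite subn0.
  have [ltmL|leLm] := ltnP m L; last first.
    by move: IHm; rewrite (eqP leLm) (eqP (leqW leLm)).
  by apply: (row_step _ _).1; rewrite subnSK.
split; last exact: (eq_sites 0%N).
apply: eq_from_tnth => j; rewrite !(tnth_nth mset0).
by apply: (row_step _ _).2; apply: eq_sites.
Qed.

Lemma ringing_site_idle (D : seq {mset 'I_n}) i m :
  (forall j, (j < m)%N -> i \notin nth mset0 D j) -> ringing_site D i m = i.
Proof.
elim: m => //= m IHm idle.
rewrite IHm => [|j ltjm]; last exact: idle (ltnW _).
by rewrite (negbTE (idle m _)).
Qed.

(** The path leaves i at the first row containing i, if there is one, and from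
    then on its current site is always the landing place of the last moved
    particle.  The induction needs the statement for every initial segment of
    the rows. *)
Lemma has_ringing_site D i m :
  has (fun j => ringing_site D i m \in nth mset0 (ringing_rows D i) j)
      (iota 0 m) =
  has (fun j => i \in nth mset0 D j) (iota 0 m).
Proof.
elim: m => // m IHm; rewrite -addn1 iotaD !has_cat /= !orbF add0n addn1.
rewrite ringing_siteS nth_ringing_rows next_site_in_move_right.
case: (boolP (has (fun j => i \in _) _)) => [has_i|/hasPn idle].
  rewrite /next_site; case: ifPn => [|_]; first by rewrite orbT.
  by rewrite IHm has_i.
have -> : ringing_site D i m = i.
  by apply: ringing_site_idle => j ltjm; apply: idle; rewrite mem_iota.
rewrite /next_site /=; case: ifPn => [|iD]; first by rewrite orbT.
rewrite orbF; apply: negbTE; move: IHm.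
rewrite ringing_site_idle => [->|j ltjm]; last by apply: idle; rewrite mem_iota.
exact/hasPn.
Qed.

(** The factors x_(a_(j+1)) / x_(a_j) contributed by the successive rows
    telescope. *)
Lemma row_weight_ringing (R : realFieldType) (x : 'I_n -> R) D i m :
  (\prod_(j < m) row_weight x (nth mset0 (ringing_rows D i) j)) * x i =
  (\prod_(j < m) row_weight x (nth mset0 D j)) * x (ringing_site D i m).
Proof.
elim: m => [|m IHm]; first by rewrite !big_ord0.
rewrite 2!big_ord_recr ringing_siteS [LHS]mulrAC IHm -[RHS]mulrA.
rewrite -row_weight_move_right -nth_ringing_rows -[LHS]mulrA.
by congr (_ * _); rewrite mulrC.
Qed.

End RingingPath.

Section Balance.

Variables (R : realFieldType) (n L : nat) (lam : L.-tuple nat).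
Variable (x : 'I_n -> R).
Hypothesis x_gt0 : forall i, 0 < x i.
Implicit Types (D : bMLQ n lam) (i : 'I_n) (p : bMLQ n lam * 'I_n).

Lemma wt_rows D : wt x D = \prod_(j < L) row_weight x (nth mset0 D j).
Proof.
rewrite /wt /row_weight exchange_big /=; apply: eq_bigr => i _.
rewrite -prodrXr; apply: eq_bigr => j _.
by rewrite (tnth_nth mset0).
Qed.

Lemma column_nonemptyE D i :
  column_nonempty D i = has (fun j => i \in nth mset0 D j) (iota 0 L).
Proof.
apply/existsP/hasP => [[j iDj]|[j]].
  by exists (val j); rewrite ?mem_iota //= -tnth_nth.
rewrite mem_iota => ltjL iDj.
by exists (Ordinal ltjL); rewrite (tnth_nth mset0).
Qed.

Definition ring_end p : bMLQ n lam * 'I_n :=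
  (ringing p.1 p.2, ringing_site p.1 p.2 L).

Lemma ring_end_inj : injective ring_end.
Proof.
move=> [D i] [E k] eq_ring.
have /= [eqDE ->] := ringing_rows_inj
  (congr1 (fun p => bmlq_rows p.1) eq_ring) (congr1 snd eq_ring).
by congr (_, _); apply: val_inj.
Qed.

Definition flow p : R := wt x p.1 * trigger_rate x p.1 p.2.

(** The out-flow of a queue through a trigger i equals the out-flow of the
    resulting queue through the end of the path, which turns global balance into
    a reindexing of sums. *)
Lemma flow_ring_end p : flow (ring_end p) = flow p.
Proof.
case: p => D i; rewrite /flow /ring_end /trigger_rate /=.
have wt_ring : wt x (ringing D i) * x i = wt x D * x (ringing_site D i L).
  by rewrite !wt_rows row_weight_ringing.
have xu k : x k != 0 by rewrite gt_eqF.
rewrite (column_nonemptyE (ringing D i)) has_ringing_site -column_nonemptyE.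
case: ifPn => [_|]; first by apply/eqP; rewrite eqr_div // wt_ring.
rewrite column_nonemptyE => /hasPn empty; congr (_ * _).
apply: (mulIf (xu i)); rewrite wt_ring ringing_site_idle // => j ltjL.
by apply: empty; rewrite mem_iota.
Qed.

Lemma sum_rate D : \sum_(E : bMLQ n lam) rate x D E = \sum_i trigger_rate x D i.
Proof. by rewrite [RHS](partition_big (ringing D) predT). Qed.

End Balance.

Theorem theorem5p6 (R : realFieldType) (n : nat) (n_ge1 : (1 <= n)%N)
    (x : 'I_n -> R) (x_gt0 : forall i : 'I_n, 0 < x i)
    (L : nat) (lam : L.-tuple nat) (lam_partition : sorted geq lam)
    (D : bMLQ n lam) :
  wt x D * (\sum_(D' : bMLQ n lam) rate x D D') =
  \sum_(D' : bMLQ n lam) wt x D' * rate x D' D.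
Proof.
rewrite sum_rate mulr_sumr.
transitivity (\sum_(p : bMLQ n lam * 'I_n | p.1 == D) flow x p).
  rewrite -(big_pred1_eq +%R D (fun E => \sum_i flow x (E, i))) pair_big /=.
  by apply: eq_big => [p|[E i] _] //; rewrite andbT.
rewrite (reindex_inj (@ring_end_inj n L lam)) /=.
under eq_bigr => p _ do rewrite flow_ring_end //.
under [RHS]eq_bigr => E _ do rewrite mulr_sumr.
by rewrite pair_big_dep.
Qed.
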